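(* Let $\beta \ge 2$ be an integer and suppose that $a \le b < \beta$ is a reversed sum-product pair for the base $\beta$. Then exactly one of the following is true: (i) $(a,b) = (2,2)$ and $\beta \ge 5$; or (ii) $(a,b) = (\beta-1,\beta-1)$ and $\beta \ge 3$.
   Context: A base-$\beta$ representation of a positive integer is canonical if it has no leading zero. A pair of positive integers $a \le b$ is a reversed sum-product pair for the base $\beta$ if the canonical base-$\beta$ representations of $a+b$ and $ab$ are the reverse of each other as digit strings (in particular they have the same number of digits). *)

(* Defs.v *)
From mathcomp Require Import all_boot.

Set Implicit Arguments.
Unset Strict Implicit.
Unset Printing Implicit Defensive.

(* Digit strings are written most significant digit first, so the digit of
   weight [beta ^ i] is the [i]-th entry of the reversed string. *)
Definition digits_value (beta : nat) (s : seq nat) : nat :=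
  \sum_(i < size s) nth 0 (rev s) i * beta ^ i.

(* The default value 0 of [head] makes the last conjunct reject the empty
   string as well as strings with a leading zero. *)
Definition canonical_rep (beta n : nat) (s : seq nat) : Prop :=
  [/\ digits_value beta s = n, all (fun d => d < beta) s & head 0 s != 0].

Definition reversed_sum_product_pair (beta a b : nat) : Prop :=
  [/\ 0 < a, a <= b &
      exists s t : seq nat,
        [/\ canonical_rep beta (a + b) s,
            canonical_rep beta (a * b) t & t = rev s]].

Definition exactly_one (P Q : Prop) : Prop := (P /\ ~ Q) \/ (~ P /\ Q).

(* Main.v *)
Require Import Defs.
From mathcomp Require Import all_boot.
From mathcomp Require Import zify.

(** Since [a + b < 2 * beta], the sum has one or two digits. With one digit,
    [a + b = a * b], that is [(a - 1) * (b - 1) = 1]. With two digits, the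
    leading digit is 1, so [a + b = beta + d] and [a * b = d * beta + 1];
    eliminating [d] gives [(beta - a) * (beta - b) = 1]. *)

Lemma digits_value_cons (beta x : nat) (s : seq nat) :
  digits_value beta (x :: s) = x * beta ^ size s + digits_value beta s.
Proof.
rewrite /digits_value /= big_ord_recr /= rev_cons nth_rcons size_rev ltnn eqxx.
rewrite addnC; congr (_ + _); apply: eq_bigr => i _.
by rewrite nth_rcons size_rev ltn_ord.
Qed.

Lemma digits_value_nil (beta : nat) : digits_value beta [::] = 0.
Proof. by rewrite /digits_value big_ord0. Qed.

(** A nonzero leading digit already contributes at least [beta ^ (size s - 1)] to the value. *)
Lemma canonical_rep_size_le2 (beta n : nat) (s : seq nat) :
  1 < beta -> n < beta ^ 2 -> canonical_rep beta n s -> size s <= 2.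
Proof.
move=> beta_gt1 n_lt [val_s _]; case: s val_s => [|x s] //= val_s x_neq0.
rewrite -[_ <= 2](ltn_exp2l _ _ beta_gt1) (leq_ltn_trans _ n_lt) // -val_s.
by rewrite digits_value_cons (leq_trans _ (leq_addr _ _)) // leq_pmull ?lt0n.
Qed.

Theorem mainTheorem6 (beta a b : nat) (hbeta : 2 <= beta)
  (hab : a <= b < beta) (hpair : reversed_sum_product_pair beta a b) :
  exactly_one ((a, b) = (2, 2) /\ 5 <= beta)
              ((a, b) = (beta - 1, beta - 1) /\ 3 <= beta).
Proof.
have /andP[le_ab lt_b] := hab.
case: hpair => a_gt0 _ [s [t [sum_s prod_t t_rev]]].
have sum_lt : a + b < beta ^ 2 by rewrite expnS expn1; nia.
have size_s := canonical_rep_size_le2 _ _ _ hbeta sum_lt sum_s.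
have [[val_s digits_s head_s] [val_t digits_t head_t]] := (sum_s, prod_t).
rewrite {}t_rev in val_t digits_t head_t.
(* The empty string contradicts [head_s], and three or more digits contradict [size_s]. *)
case: s size_s {sum_s prod_t} val_s digits_s head_s val_t digits_t head_t
  => [|x [|d []]] // _; rewrite ?[rev _]/= !digits_value_cons digits_value_nil /=
  expn0 ?expn1 !muln1 !addn0.
- move=> sum_x /andP[x_lt _] _ prod_x _ _.
  have a2 : a = 2 by nia.
  have b2 : b = 2 by nia.
  (* Here [x = 4] is a digit, so [beta] exceeds 4; the other alternative would force [beta = 3]. *)
  by left; split; [rewrite a2 b2; split => //; lia | case=> -[]; lia].
- move=> sum_xd /andP[_ /andP[d_lt _]] x_neq0 prod_dx _ d_neq0.
  (* [x * beta <= a + b < 2 * beta] and [x] is nonzero. *)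
  have x1 : x = 1 by nia.
  rewrite {}x1 {x_neq0} mul1n in sum_xd prod_dx.
  have prod1 : (beta - a) * (beta - b) = 1 by nia.
  move/eqP: prod1; rewrite muln_eq1 => /andP[/eqP beta_a /eqP beta_b].
  have a_eq : a = beta - 1 by lia.
  have b_eq : b = beta - 1 by lia.
  (* Now [d = beta - 2], which is nonzero as the leading digit of the product, so [beta >= 3].
     Having [a = 2] as well would give [beta = 3], below 5. *)
  by right; split; [case=> -[]; lia | rewrite {1}a_eq {1}b_eq; split => //; lia].
Qed.
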